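(* For every integer $t \geq 2$, for every integer $k \geq 1$, and for every $P_t$-free graph $G$ with $\mathrm{td}_2(G) \leq k$, \[ \mathrm{td}(G) < 2 \binom{\lfloor (t-1)/2 \rfloor + k - 1}{\lfloor (t-1)/2 \rfloor}. \]
   Context: Graphs are finite and simple; the null graph has no vertices; connected graphs have at least one vertex. $P_t$ denotes the path on $t$ vertices. A graph $G$ is $H$-free if $G$ does not contain $H$ as an induced subgraph. A cut-vertex of a graph $G$ is a vertex $v$ such that $G-v$ has more components than $G$. A block of $G$ is a maximal connected subgraph of $G$ without a cut-vertex (so blocks are maximal 2-connected subgraphs, cut edges with their endpoints, or isolated vertices). ''$G$ is a block'' means that $G$ is connected and has no cut-vertex. Treedepth $\mathrm{td}(G)$ is defined recursively: $\mathrm{td}(G)=0$ if $G$ is the null graph; $\mathrm{td}(G)=\min_{v\in V(G)}\mathrm{td}(G-v)+1$ if $G$ is connected; $\mathrm{td}(G)=\max_i \mathrm{td}(C_i)$ if $G$ has components $C_1,\dots,C_m$ with $m>1$. 2-treedepth $\mathrm{td}_2(G)$ is defined recursively: $\mathrm{td}_2(G)=0$ if $G$ is the null graph; $\mathrm{td}_2(G)=\min_{v\in V(G)}\mathrm{td}_2(G-v)+1$ if $G$ is a block; $\mathrm{td}_2(G)=\max_i \mathrm{td}_2(B_i)$ if $G$ has blocks $B_1,\dots,B_m$ with $m>1$. *)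

(* Defs.v *)
From HB Require Import structures.
From mathcomp Require Import all_boot.

Set Implicit Arguments.
Unset Strict Implicit.
Unset Printing Implicit Defensive.

(* The vertex set is an arbitrary subset of the ambient type [T], so that all
   the subgraphs of a graph have the same type as the graph itself. *)
Record graph (T : finType) := Graph {
  graph_val :> {set T} * {set {set T}};
  graph_valP : [forall f in graph_val.2, (f \subset graph_val.1) && (#|f| == 2)]
}.

HB.instance Definition _ (T : finType) := [isSub for @graph_val T].
HB.instance Definition _ (T : finType) := [Finite of graph T by <:].

Section Graphs.

Variable T : finType.
Implicit Types (G H K : graph T) (A : {set T}) (P : pred (graph T)).

Definition vset G : {set T} := (graph_val G).1.
Definition eset G : {set {set T}} := (graph_val G).2.

(* Irreflexive, since [set x; x] has only one element. *)
Definition adj G : rel T := [rel x y | [set x; y] \in eset G].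

Definition subgraph H G : bool :=
  (vset H \subset vset G) && (eset H \subset eset G).

Lemma induced_subproof G A :
  let p := (vset G :&: A, [set f in eset G | f \subset A]) in
  [forall f in p.2, (f \subset p.1) && (#|f| == 2)].
Proof.
apply/forall_inP => f /=; rewrite inE => /andP[fE fA].
have /andP[fV ->] := forall_inP (graph_valP G) f fE.
by rewrite andbT subsetI fV.
Qed.

Definition induced G A : graph T := Graph (induced_subproof G A).

Definition del G (v : T) : graph T := induced G (~: [set v]).

Definition connected G : bool :=
  (vset G != set0) &&
  [forall x in vset G, forall y in vset G, connect (adj G) x y].

Definition maximal_subgraphs P G : {set graph T} :=
  [set H | [&& subgraph H G, P H &
            [forall K, [&& subgraph H K, subgraph K G & P K] ==> (K == H)]]].

Definition components G : {set graph T} := maximal_subgraphs connected G.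

Definition cut_vertex G (v : T) : bool :=
  (v \in vset G) && (#|components G| < #|components (del G v)|).

Definition is_block G : bool := connected G && [forall v, ~~ cut_vertex G v].

Definition blocks G : {set graph T} := maximal_subgraphs is_block G.

(* The default value of the iterated minimum is the maximum over the same
   range, so this is the true minimum whenever [A] is nonempty. *)
Definition min_over A (F : T -> nat) : nat :=
  \big[minn/(\max_(v in A) F v)]_(v in A) F v.

(* The common shape of treedepth ([P] = connected) and 2-treedepth ([P] = being
   a block).  Every recursive call is on a graph with a smaller [gsize], so
   [gsize G] steps are always enough; see [depthE]. *)
Definition gsize G : nat := #|vset G| + #|eset G|.

Fixpoint depth_rec P (n : nat) G : nat :=
  if n is n'.+1 then
    if vset G == set0 then 0
    else if P G then (min_over (vset G) (fun v => depth_rec P n' (del G v))).+1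
    else \max_(H in maximal_subgraphs P G) depth_rec P n' H
  else 0.

Definition depth P G : nat := depth_rec P (gsize G) G.

Definition td G : nat := depth connected G.
Definition td2 G : nat := depth is_block G.

Lemma gsize_del G v : v \in vset G -> gsize (del G v) < gsize G.
Proof.
move=> vG; rewrite /gsize -addSn; apply: leq_add.
  apply: proper_card; apply/properP; split; first exact: subsetIl.
  by exists v; rewrite // !inE eqxx andbF.
by apply: subset_leq_card; apply/subsetP => f; rewrite inE => /andP[].
Qed.

Lemma gsize_sub H G : subgraph H G -> H != G -> gsize H < gsize G.
Proof.
move=> /andP[sV sE]; apply: contraNT; rewrite -leqNgt /gsize => le.
have leV := subset_leq_card sV; have leE := subset_leq_card sE.
have eqV : vset H = vset G.
  apply/eqP; rewrite eqEcard sV /= -(leq_add2r #|eset G|).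
  by apply: leq_trans le _; rewrite leq_add2l.
have eqE : eset H = eset G.
  apply/eqP; rewrite eqEcard sE /= -(leq_add2l #|vset G|).
  by apply: leq_trans le _; rewrite leq_add2r.
apply/eqP/val_inj => /=; rewrite (surjective_pairing (graph_val H)) (surjective_pairing (graph_val G)).
by rewrite -/(vset H) -/(eset H) eqV eqE.
Qed.

Lemma gsize_part P G H :
  ~~ P G -> H \in maximal_subgraphs P G -> gsize H < gsize G.
Proof.
move=> nPG; rewrite inE => /and3P[sHG PH _]; apply: gsize_sub => //.
by apply: contraNneq nPG => <-.
Qed.

Lemma eq_min_over A F1 F2 :
  {in A, F1 =1 F2} -> min_over A F1 = min_over A F2.
Proof.
move=> eqF; rewrite /min_over (eq_bigr F2 (idx := 0) eqF).
exact: eq_bigr.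
Qed.

Lemma depth_rec_fuel P n m G :
  gsize G <= n -> gsize G <= m -> depth_rec P n G = depth_rec P m G.
Proof.
elim: n m G => [|n IH] [|m] G //=.
- rewrite leqn0 addn_eq0 => /andP[/eqP/cards0_eq -> _] _; by rewrite eqxx.
- move=> _; rewrite leqn0 addn_eq0 => /andP[/eqP/cards0_eq -> _]; by rewrite eqxx.
move=> len lem; case: ifP => // _; case: ifPn => [_|nPG].
  congr _.+1; apply: eq_min_over => v vG; have lt := gsize_del vG.
  by apply: IH; rewrite -ltnS; apply: leq_trans lt _.
apply: eq_bigr => H HG; have lt := gsize_part nPG HG.
by apply: IH; rewrite -ltnS; apply: leq_trans lt _.
Qed.

Lemma depthE P G :
  depth P G =
    if vset G == set0 then 0
    else if P G then (min_over (vset G) (fun v => depth P (del G v))).+1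
    else \max_(H in maximal_subgraphs P G) depth P H.
Proof.
rewrite {1}/depth (@depth_rec_fuel P _ (gsize G).+1) //=.
case: ifP => // _; case: ifPn => [_|nPG].
  congr _.+1; apply: eq_min_over => v vG.
  by apply: depth_rec_fuel => //; apply: ltnW; apply: gsize_del.
apply: eq_bigr => H HG.
by apply: depth_rec_fuel => //; apply: ltnW; apply: gsize_part HG.
Qed.

Lemma min_overP A F v0 : v0 \in A ->
  (forall v, v \in A -> min_over A F <= F v) /\
  (exists2 v, v \in A & min_over A F = F v).
Proof.
move=> v0A; split=> [v vA|].
  rewrite /min_over; move: (\max_(v in A) F v) => d; rewrite unlock.
  have : v \in index_enum T by rewrite mem_index_enum.
  elim: (index_enum T) => //= u s IH; rewrite inE => /predU1P[<-|/IH le].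
    by rewrite vA geq_minl.
  by case: ifP => // _; rewrite geq_min le orbT.
rewrite /min_over; have [w wA ->] : exists2 w, w \in A & \max_(v in A) F v = F w.
  by have [|w] := @eq_bigmax_cond _ (mem A) F; [apply/card_gt0P; exists v0 | exists w].
elim/big_ind: _ => [|x y [u uA ->] [v vA ->]|v vA]; first by exists w.
- by case: (leqP (F u) (F v)) => _; [exists u | exists v].
- by exists v.
Qed.

Lemma maximal_subgraphs_self P G : P G -> maximal_subgraphs P G = [set G].
Proof.
move=> PG; have sGG : subgraph G G by rewrite /subgraph !subxx.
apply/setP => H; rewrite !inE; apply/and3P/eqP => [[sHG PH /forallP/(_ G)]|->].
  by rewrite sHG sGG PG /= => /eqP.
split=> //; apply/forallP => K; apply/implyP => /and3P[/andP[s1 s2] /andP[s3 s4] _].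
apply: contraT => /gsize_sub lt; have := lt _; rewrite ltnNge /gsize.
rewrite leq_add ?subset_leq_card //; apply; exact/andP.
Qed.

Lemma depth_many P G : (forall H, P H -> vset H != set0) ->
  1 < #|maximal_subgraphs P G| ->
  depth P G = \max_(H in maximal_subgraphs P G) depth P H.
Proof.
move=> Pn0 gt1; rewrite depthE; case: ifPn => [/eqP G0|_]; last first.
  by case: ifPn => // /maximal_subgraphs_self eG; rewrite eG cards1 in gt1.
have /card_gt0P[H] := ltnW gt1; rewrite inE => /and3P[/andP[sV _] PH _].
by have := Pn0 _ PH; rewrite -subset0 -G0 sV.
Qed.

Lemma td_null G : vset G = set0 -> td G = 0.
Proof. by rewrite /td depthE => ->; rewrite eqxx. Qed.

Lemma td_connected G : connected G ->
  td G = min_over (vset G) (fun v => td (del G v)) + 1.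
Proof.
by move=> cG; rewrite /td depthE cG addn1 ifN //; case/andP: cG.
Qed.

Lemma td_components G : 1 < #|components G| ->
  td G = \max_(H in components G) td H.
Proof. by apply: depth_many => H /andP[]. Qed.

Lemma td2_null G : vset G = set0 -> td2 G = 0.
Proof. by rewrite /td2 depthE => ->; rewrite eqxx. Qed.

Lemma td2_block G : is_block G ->
  td2 G = min_over (vset G) (fun v => td2 (del G v)) + 1.
Proof.
by move=> bG; rewrite /td2 depthE bG addn1 ifN //; case/andP: bG => /andP[].
Qed.

Lemma td2_blocks G : 1 < #|blocks G| ->
  td2 G = \max_(H in blocks G) td2 H.
Proof. by apply: depth_many => H /andP[/andP[]]. Qed.

End Graphs.

Definition isomorphic (S T : finType) (H : graph S) (G : graph T) : Prop :=
  exists f : {x | x \in vset H} -> {y | y \in vset G},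
    bijective f /\ forall x y, adj G (val (f x)) (val (f y)) = adj H (val x) (val y).

Definition free (S T : finType) (H : graph S) (G : graph T) : Prop :=
  ~ exists2 A : {set T}, A \subset vset G & isomorphic H (induced G A).

Lemma path_graph_subproof t :
  let p := ([set: 'I_t],
            [set f : {set 'I_t} | [exists i : 'I_t, exists j : 'I_t,
                                   (j == i.+1 :> nat) && (f == [set i; j])]]) in
  [forall f in p.2, (f \subset p.1) && (#|f| == 2)].
Proof.
apply/forall_inP => f /=; rewrite inE subsetT /=.
case/existsP => i /existsP[j /andP[/eqP ij /eqP ->]]; rewrite cards2.
by rewrite -val_eqE /= ij neq_ltn ltnSn.
Qed.

Definition path_graph t : graph 'I_t := Graph (path_graph_subproof t).

(* Main.v *)
(* The bound is proved for a treedepth relative to a set S, which counts the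
   rounds needed until no vertex of S is left, for graphs in which every induced
   path with both ends in S has at most 2s + 1 vertices; the theorem is the case
   where S contains all vertices.  In a connected graph let S' be the set of
   vertices separating two vertices of S.  An induced path between two vertices
   of S' extends at both ends to one between vertices of S, so induction on s
   bounds the rounds needed to eliminate S'.  Afterwards the vertices of S in one
   component are not separated by any vertex of the original graph, hence lie in
   a 2-connected part M, and vertices outside M do not help to connect vertices
   of M: removing one vertex lowers the 2-treedepth of M and induction on k
   applies.  Thus the bound b satisfies
   b(s + 1, k + 1) = b(s, k + 1) + b(s + 1, k) + 1. *)

Require Import Defs.
From mathcomp Require Import all_boot.

Set Implicit Arguments.
Unset Strict Implicit.
Unset Printing Implicit Defensive.

(** * Elimination on vertex sets of a relation *)

Section Elimination.

Variables (T : finType) (e : rel T).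
Implicit Types (A B C M S X Y Z : {set T}).

Definition within A : rel T := [rel x y | [&& x \in A, y \in A & e x y]].

Definition conn A : bool :=
  (A != set0) && [forall x in A, forall y in A, connect (within A) x y].

(** An empty [A :\ v] is allowed, so singletons qualify, just as single vertices satisfy
    [is_block]. *)
Definition biconn A : bool :=
  conn A && [forall v in A, (A :\ v == set0) || conn (A :\ v)].

(* Treedepth of [A] relative to [S] is at most [n].  Quantifying over all
   connected subsets instead of the components makes monotonicity immediate. *)
Fixpoint elim S n A : Prop :=
  if n is n'.+1 then
    forall C, C \subset A -> conn C -> exists v, elim S n' (C :\ v)
  else [disjoint A & S].

(* 2-treedepth at most [n], with all 2-connected subsets in place of the blocks. *)
Fixpoint elim2 n A : Prop :=
  if n is n'.+1 then
    forall C, C \subset A -> biconn C -> exists v, elim2 n' (C :\ v)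
  else A = set0.

Lemma connP A :
  reflect (A != set0 /\ {in A &, forall x y, connect (within A) x y}) (conn A).
Proof.
apply: (iffP andP) => -[A0 H]; split=> //.
  by move=> x y xA yA; have /forall_inP/(_ y yA) := forall_inP H x xA.
by apply/forall_inP => x xA; apply/forall_inP => y yA; apply: H.
Qed.

Lemma connect_within_mono A B x y :
  A \subset B -> connect (within A) x y -> connect (within B) x y.
Proof.
move=> /subsetP sAB; apply: connect_sub => {}x {}y /and3P[xA yA exy].
by apply: connect1; apply/and3P; split; rewrite ?sAB.
Qed.

Lemma path_within_mem A x p : path (within A) x p -> {subset p <= A}.
Proof.
elim: p x => //= y p IH x /andP[/and3P[_ yA _] /IH sp] z.
by rewrite inE => /predU1P[->|/sp].
Qed.

Lemma path_within_sub A B x p :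
  path (within A) x p -> {subset x :: p <= B} -> path (within B) x p.
Proof.
elim: p x => //= y p IH x /andP[/and3P[_ _ exy] pyp] sB.
rewrite /within /= exy !sB ?inE ?eqxx ?orbT //=.
by apply: IH => // z zp; apply: sB; rewrite inE zp orbT.
Qed.

Lemma path_connect_within A x p y :
  path (within A) x p -> y \in x :: p -> connect (within A) x y.
Proof. by move=> pxp /(path_connect pxp). Qed.

Lemma connect_within_mem A x y : x \in A -> connect (within A) x y -> y \in A.
Proof.
move=> xA /connectP[p pxp ->]; have := mem_last x p; rewrite inE.
by case/predU1P=> [->//|/(path_within_mem pxp)].
Qed.

Lemma elim_sub S n A B : A \subset B -> elim S n B -> elim S n A.
Proof.
case: n => [|n] /= sAB; first exact: disjointWl.
by move=> H C sCA; apply: H; apply: subset_trans sAB.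
Qed.

Lemma elim2_sub n A B : A \subset B -> elim2 n B -> elim2 n A.
Proof.
case: n => [|n] /= sAB; first by move=> B0; apply/eqP; rewrite -subset0 -B0.
by move=> H C sCA; apply: H; apply: subset_trans sAB.
Qed.

Lemma elim_disjoint S n A : [disjoint A & S] -> elim S n A.
Proof.
elim: n A => //= n IH A dAS C sCA /connP[/set0Pn[v _] _]; exists v.
by apply: IH; apply: disjointWl dAS; apply: subset_trans sCA; apply: subsetDl.
Qed.

Lemma elim_conn S n A :
  (forall C, C \subset A -> conn C -> elim S n.+1 C) -> elim S n.+1 A.
Proof. by move=> H C sCA cC; apply: (H C). Qed.

(** Two strategies are played in succession: once [S'] is exhausted, every remaining connected piece
    avoids [S'] and is finished in [m] more rounds. *)
Lemma elim_add S S' n m A : elim S' n A ->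
  (forall C, C \subset A -> [disjoint C & S'] -> elim S m C) -> elim S (n + m) A.
Proof.
elim: n A => [|n IH] A /=; first by move=> d; apply.
move=> H Hm C sCA cC; have [v Hv] := H C sCA cC; exists v; apply: IH => // X sX.
apply: Hm; apply: subset_trans sX (subset_trans (subsetDl _ _) sCA).
Qed.

(** * Gated sets and biconnectivity *)

(* Sets such as the unions of blocks that form a subtree of the block tree:
   a walk that leaves [M] can be shortcut inside [M]. *)
Definition gated A M : bool :=
  [forall Y : {set T}, (Y \subset A) && conn Y ==> (Y :&: M == set0) || conn (Y :&: M)].

Lemma gatedP A M :
  reflect (forall Y, Y \subset A -> conn Y -> Y :&: M = set0 \/ conn (Y :&: M))
          (gated A M).
Proof.
apply: (iffP forallP) => H Y.
  move=> sY cY; have := H Y; rewrite sY cY /= => /orP[/eqP|]; by [left|right].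
by apply/implyP => /andP[sY cY]; have [->|->] := H Y sY cY; rewrite ?eqxx ?orbT.
Qed.

(** A strategy for [Z :&: M] also works on [Z]: a connected [Y] in [Z] either misses [M], and hence
    [S], or meets [M] in a connected set, whose chosen vertex serves for [Y]. *)
Lemma elim_gated A M S n Z : gated A M -> Z \subset A -> Z :&: S \subset M ->
  elim S n (Z :&: M) -> elim S n Z.
Proof.
move=> /gatedP gM; elim: n Z => [|n IH] Z sZA sZM /=.
  rewrite -!setI_eq0 => /eqP ZMS; rewrite -subset0 -ZMS setIAC subsetI sZM.
  by rewrite subxx.
move=> H Y sYZ cY; have sYM : Y :&: S \subset M.
  by apply: subset_trans sZM; apply: setSI.
have sYA := subset_trans sYZ sZA; have [Y0|cYM] := gM Y sYA cY.
  have [/set0Pn[v _] _] := connP _ cY; exists v; apply: elim_disjoint.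
  apply: disjointWl (subsetDl _ _) _; rewrite -setI_eq0 -subset0 -Y0.
  by rewrite subsetI subsetIl.
have [|v Hv] := H (Y :&: M) _ cYM; first exact: setSI.
exists v; apply: IH; first exact: subset_trans (subsetDl _ _) sYA.
  by apply: subset_trans sYM; apply: setSI; apply: subsetDl.
by rewrite setIDAC.
Qed.

Hypothesis e_sym : symmetric e.

Lemma within_sym A : symmetric (within A).
Proof. by move=> x y; rewrite /within /= e_sym; case: (x \in A); case: (y \in A). Qed.

Lemma connect_within_sym A : connect_sym (within A).
Proof. exact/sym_connect_sym/within_sym. Qed.

Definition comp A x : {set T} := [set y | connect (within A) x y].

Lemma comp_sub A x : x \in A -> comp A x \subset A.
Proof. by move=> xA; apply/subsetP => y; rewrite inE => /(connect_within_mem xA). Qed.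

Lemma comp_refl A x : x \in comp A x. Proof. by rewrite inE connect0. Qed.

Lemma conn_base A x : x \in A ->
  {in A, forall y, connect (within A) x y} -> conn A.
Proof.
move=> xA H; apply/connP; split=> [|y z yA zA]; first by apply/set0Pn; exists x.
by apply: connect_trans (H z zA); rewrite connect_within_sym H.
Qed.

Lemma conn_comp A x : conn (comp A x).
Proof.
apply: (conn_base (comp_refl A x)) => y; rewrite inE => /connectP[p pxp ->].
apply/connectP; exists p => //; apply: (path_within_sub (pxp)) => z zp.
by rewrite inE (path_connect_within pxp zp).
Qed.

Lemma gated_connect A M X x y : gated A M -> X \subset A -> x \in X :&: M ->
  y \in M -> connect (within X) x y -> connect (within (X :&: M)) x y.
Proof.
move=> /gatedP gM sXA /setIP[xX xM] yM cxy.
have sC := comp_sub xX; have xC : x \in comp X x :&: M by rewrite inE comp_refl.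
have [C0|/connP[_ cC]] := gM _ (subset_trans sC sXA) (conn_comp X x).
  by rewrite C0 inE in xC.
by apply: connect_within_mono (setSI M sC) _; apply: cC; rewrite // inE yM inE cxy.
Qed.

(* In an inclusion-minimal gated set a cut vertex [v] would leave a smaller
   one: [v] with the component of [M :\ v] that meets [X]. *)
Lemma minimal_gated_biconn A X M : conn A -> M \subset A ->
    (exists x, x \in X) ->
    (forall v a b, a \in X -> b \in X -> a != v -> b != v ->
       connect (within (A :\ v)) a b) ->
  minset (fun M : {set T} => gated A M && (X \subset M)) M -> biconn M.
Proof.
move=> cA sMA [x0 x0X] nsep /minsetP[/andP[gM sXM] minM].
have cM : conn M.
  have /gatedP/(_ A (subxx A) cA) := gM; rewrite (setIidPr sMA) => -[M0|//].
  by have := subsetP sXM _ x0X; rewrite M0 inE.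
rewrite /biconn cM; apply/forall_inP => v vM; apply/norP => -[/set0Pn[p pM]].
move=> ncM.
(* All of [X] except [v] lies in one component of [M :\ v]: its vertices are connected in [A :\ v],
   and gatedness moves the connection into [M]. *)
have [a aM aX] : exists2 a, a \in M :\ v & X \subset v |: comp (M :\ v) a.
  have [Xv|] := boolP (X \subset [set v]).
    by exists p => //; apply: subset_trans Xv (subsetUl _ _).
  case/subsetPn => a aX; rewrite inE => av; exists a.
    by rewrite !inE av (subsetP sXM).
  apply/subsetP => b bX; rewrite !inE; have [//|bv] := eqVneq b v.
  have := nsep v a b aX bX av bv.
  have /gated_connect H := gM; move/H => {}H.
  apply: (connect_within_mono _ (H _ _ _)).
  - by rewrite setIDAC (setIidPr sMA).
  - exact: subsetDl.
  - by rewrite !inE av !(subsetP sMA, subsetP sXM).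
  - exact: (subsetP sXM).
set N := comp (M :\ v) a in aX.
have sNM : N \subset M :\ v by apply: comp_sub.
have sM'M : v |: N \subset M.
  by rewrite subUset sub1set vM (subset_trans sNM (subsetDl _ _)).
(* If [v |: N] is gated, minimality makes it equal to [M], so [M :\ v] is the connected set [N], a
   contradiction. *)
suff gM' : gated A (v |: N).
  case/negP: ncM; suff <- : N = M :\ v by apply: conn_comp.
  have <- : v |: N = M by apply: minM => //; rewrite gM' aX.
  apply/setP => y; rewrite !inE; case: eqP => [->|//].
  by apply/negP => /(connect_within_mem aM); rewrite !inE eqxx.
apply/gatedP => Y sYA cY; have [YM|cYM] := (gatedP _ _ gM) Y sYA cY.
  by left; apply/eqP; rewrite -subset0 -YM setIS.
have -> : Y :&: (v |: N) = (Y :&: M) :&: (v |: N).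
  by rewrite -setIA (setIidPr sM'M).
have [_ cYMP] := connP _ cYM; set Y1 := Y :&: M in cYM cYMP *.
have sY1M : Y1 \subset M by apply: subsetIr.
(* If [v] lies in [Y1], a repetition-free path in [Y1] from [v] to a vertex of [N] never returns to
   [v], so after its start it stays in [N]. *)
have [vY|vY] := boolP (v \in Y1).
  right; apply: (@conn_base _ v) => [|y]; first by rewrite !inE eqxx -in_setI vY.
  case/setIP => yY; rewrite !inE => /predU1P[->//|ay].
  have /connectP[q pq yq] := cYMP _ _ vY yY; move: ay; rewrite yq => {yY y yq}.
  case/shortenP: pq => q' pq' /= /andP[vq' uq'] _ ay.
  apply/connectP; exists q' => //; apply: (path_within_sub (pq')) => z.
  rewrite inE => /predU1P[->|zq]; first by rewrite !inE eqxx -in_setI vY.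
  have qY := path_within_mem pq'; rewrite in_setI (qY _ zq) /=.
  have qM u : u \in q' -> u \in M :\ v.
    move=> uq; rewrite in_setD1 (subsetP sY1M _ (qY _ uq)) andbT.
    by apply: contraNneq vq' => <-.
  rewrite !inE; apply/orP; right; apply: connect_trans ay _.
  rewrite connect_within_sym.
  case/splitPr: zq pq' qM => q1 q2; rewrite cat_path last_cat /= => /and3P[_ _ pq2] qM.
  apply/connectP; exists q2 => //; apply: (path_within_sub (pq2)) => u uq.
  by apply: qM; rewrite mem_cat uq orbT.
(* If [v] is not in [Y1], the connected set [Y1] lies in one component of [M :\ v]: it is disjoint
   from [N] or contained in it. *)
have [N0|] := boolP (Y1 :&: N == set0).
  left; apply/eqP; rewrite setIUr (eqP N0) setU0 -subset0; apply/subsetP => y.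
  by case/setIP => yY1 /set1P yv; rewrite -yv yY1 in vY.
case/set0Pn => b /setIP[bY1 bN]; right.
suff -> : Y1 :&: (v |: N) = Y1 by [].
apply/setIidPl/subsetP => y yY1; rewrite !inE; apply/orP; right.
rewrite inE in bN; apply: connect_trans bN _.
apply: connect_within_mono (cYMP _ _ bY1 yY1); apply/subsetP => z zY1.
rewrite !inE (subsetP sY1M) // andbT; apply: contraNneq vY => <-; exact: zY1.
Qed.

(** * Induced paths and their extension beyond separators *)

(* [s] is the vertex sequence of an induced path. *)
Fixpoint ipath (s : seq T) : bool :=
  if s is x :: p then
    [&& x \notin p, (p == [::]) || e x (head x p), ~~ has (e x) (behead p) & ipath p]
  else true.

Lemma ipath_uniq s : ipath s -> uniq s.
Proof. by elim: s => //= x p IH /and4P[-> _ _ /IH]. Qed.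

Lemma ipath_catr r s : ipath (r ++ s) -> ipath s.
Proof. by elim: r => //= x r IH /and4P[_ _ _ /IH]. Qed.

Lemma ipath_path x p A : ipath (x :: p) -> {subset x :: p <= A} -> path (within A) x p.
Proof.
elim: p x => //= y p IH x /and4P[_ exy _ yp] sA.
rewrite /within /= exy !sA ?inE ?eqxx ?orbT //=; apply: IH => // z zp.
by apply: sA; rewrite inE zp orbT.
Qed.

Lemma ipath_glue r w q : ipath (rcons r w) -> ipath (w :: q) ->
  (forall x y, x \in r -> y \in q -> ~~ e x y && (x != y)) -> ipath (r ++ w :: q).
Proof.
move=> rw wq; elim: r rw => // x r IH; rewrite rcons_cons [ipath (x :: _)]/=.
case/and4P => xr exw hx rw H.
have xq y : y \in q -> ~~ e x y && (x != y) by apply: H; rewrite inE eqxx.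
rewrite cat_cons [ipath _]/= IH ?andbT => // [|y z yr zq]; last first.
  by apply: H; rewrite // inE yr orbT.
have nxq : x \notin q by apply/negP => /xq; rewrite eqxx andbF.
have nexq : ~~ has (e x) q by apply/hasPn => y /xq/andP[].
case: r xr exw hx {IH rw H} => [|z r]; rewrite /= !inE ?mem_rcons ?mem_cat ?inE !negb_or.
  by move=> -> ->; rewrite nxq nexq.
case/and3P => -> -> -> ->; rewrite -cats1 !has_cat /= !negb_or nxq nexq.
by case/and3P=> -> ->.
Qed.

Lemma ipath_rev s : ipath s -> ipath (rev s).
Proof.
elim: s => // x [|z p] IH //; rewrite [ipath _]/= => /and4P[xp exz nx /IH].
rewrite !rev_cons -!cats1 -catA /= cats1 => zp; apply: ipath_glue => //=.
  by rewrite inE eq_sym e_sym exz andbT; move: xp; rewrite inE; case: eqP.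
move=> u y; rewrite mem_rev inE => up /eqP ->; rewrite e_sym (hasPn nx) //=.
by apply: contraNneq xp => <-; rewrite inE up orbT.
Qed.

(** The new path enters [s] at its last vertex equal or adjacent to [x]; recursing into the tail
    whenever possible finds that vertex. *)
Lemma ipath_cons x s : ipath s -> (x \in s) || has (e x) s ->
  exists p, [/\ ipath (x :: p), last x p = last x s & {subset p <= s}].
Proof.
elim: s => // z s IH /[dup] zs /=; case/and4P=> _ _ _ s_ip.
have [xs _|] := boolP ((x \in s) || has (e x) s).
  have [p [xp lp sp]] := IH s_ip xs; exists p; split=> // [|y /sp ys].
    by rewrite lp; case: (s) xs.
  by rewrite inE ys orbT.
rewrite negb_or inE => /andP[nxs nexs]; have [-> _|xz] := eqVneq x z.
  by exists s; split=> // y ys; rewrite inE ys orbT.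
rewrite (negPf nxs) (negPf nexs) /= orbF => exz; exists (z :: s); split=> //.
by rewrite /= inE negb_or xz nxs exz nexs.
Qed.

Lemma connect_ipath A x y : x \in A -> connect (within A) x y ->
  exists p, [/\ ipath (x :: p), last x p = y & {subset x :: p <= A}].
Proof.
move=> xA /connectP[p pxp ->]; elim: p x xA pxp => [|z p IH] x xA /=.
  by move=> _; exists [::]; split=> // z; rewrite inE => /eqP ->.
case/andP => /and3P[_ zA exz] /(IH z zA)[q [zq lq sq]].
have [|r [xr lr sr]] := ipath_cons (x := x) zq; first by rewrite /= exz orbT.
exists r; split=> // [|u]; first by rewrite lr.
by rewrite inE => /predU1P[->|/sr/sq].
Qed.

(* A path [x :: p] has [(size p).+1] vertices. *)
Definition short_paths A S s : Prop :=
  forall x p, ipath (x :: p) -> {subset x :: p <= A} -> x \in S -> last x p \in S ->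
  size p <= s.*2.

Lemma short_paths_sub A B S s : A \subset B -> short_paths B S s -> short_paths A S s.
Proof. by move=> /subsetP sAB H x p xp sA; apply: H => // z /sA/sAB. Qed.

Definition separators A S : {set T} :=
  [set v in A | [exists a in S :&: (A :\ v), exists b in S :&: (A :\ v),
     ~~ connect (within (A :\ v)) a b]].

(** The path beyond [w] lies in one component of [A :\ w], and some [a] in [S] lies in another. An
    induced path from [a] to [w] stays in the component of [a] before [w], so gluing at [w] creates
    no chord. *)
Lemma extend_ipath A S w q : conn A -> w \in separators A S ->
    q != [::] -> ipath (w :: q) -> {subset w :: q <= A} ->
  exists a r, [/\ a \in S, ipath (a :: r ++ w :: q) & {subset a :: r <= A}].
Proof.
case: q => // y q /connP[_ cA]; rewrite inE => /andP[wA sep] _ wq sq.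
have /= /and4P[wyq _ _ yq] := wq.
have syq u : u \in y :: q -> u \in A :\ w.
  move=> uq; rewrite !inE sq ?andbT; last by rewrite inE uq orbT.
  by apply: contraNneq wyq => <-.
have cyq u : u \in y :: q -> connect (within (A :\ w)) y u.
  by move=> uq; apply: path_connect_within uq; apply: ipath_path.
have [a aS [aA nay]] : exists2 a, a \in S &
    a \in A :\ w /\ ~~ connect (within (A :\ w)) y a.
  (* Of two vertices of [S] separated by [w], at most one is in the component of [y]. *)
  case/exists_inP: sep => a /setIP[aS aA] /exists_inP[b /setIP[bS bA] nab].
  have [ya|] := boolP (connect (within (A :\ w)) y a); last by exists a.
  exists b => //; split=> //; apply: contra nab; apply: connect_trans.
  by rewrite connect_within_sym.
have /setD1P[aw aA'] := aA.
have [p [ap lp sp]] := connect_ipath aA' (cA a w aA' wA).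
case: (lastP p) ap lp sp => [|r w' ap]; first by move=> _ /= aw'; rewrite aw' eqxx in aw.
rewrite last_rcons => w'w; rewrite {w'}w'w in ap * => sr; exists a, r.
have sarA : {subset a :: r <= A}.
  by move=> z zr; apply: sr; rewrite -rcons_cons mem_rcons inE zr orbT.
have arw : {subset a :: r <= A :\ w}.
  move=> z zr; rewrite !inE sarA // andbT; apply: contraTneq zr => ->.
  by have := ipath_uniq ap; rewrite -rcons_cons rcons_uniq => /andP[].
suff ipc : ipath ((a :: r) ++ [:: w, y & q]) by [].
apply: ipath_glue => // x z xr zq.
have cax : connect (within (A :\ w)) x a.
  rewrite connect_within_sym; apply: path_connect_within xr.
  have := ipath_path ap sr; rewrite rcons_path => /andP[par _].
  exact: path_within_sub par arw.
have := nay; apply: contraR; rewrite negb_and !negbK => exz.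
apply: connect_trans (cyq z zq) (connect_trans _ cax).
case/orP: exz => [exz|/eqP ->]; last exact: connect0.
by apply: connect1; apply/and3P; split; [apply: syq|apply: arw|rewrite e_sym].
Qed.

Lemma short_paths_separators A S s :
  conn A -> short_paths A S s.+1 -> short_paths A (separators A S) s.
Proof.
move=> cA shA x p xp sA xS lS; rewrite leqNgt; apply/negP => lt.
have p0 : p != [::] by case: p lt {xp sA lS}.
have [a [r [aS ar sar]]] := extend_ipath cA xS p0 xp sA.
(* Reversal turns the other end into the head, so that [extend_ipath] applies again. Each extension
   adds at least one vertex, which accounts for the drop from [s.+1] to [s]. *)
have := ipath_rev ar; rewrite -cat_cons (lastI x) -rcons_cat rev_rcons => ar'.
set q' := rev _ in ar'.
have sizeq' : size q' = (size r + size p).+1.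
  by rewrite size_rev size_cat size_belast.
have sarA : {subset last x p :: q' <= A}.
  move=> z; rewrite -rev_rcons mem_rev rcons_cat -lastI mem_cat.
  by case/orP=> [/sar|/sA].
have [|b [t [bS bt sbt]]] := extend_ipath cA lS _ ar' sarA; first by rewrite -size_eq0 sizeq'.
have lq' : last (last x p) q' = a by rewrite /q' rev_cons last_rcons.
suff : size (t ++ last x p :: q') <= s.+1.*2.
  rewrite size_cat /= sizeq' doubleS !addnS !ltnS; apply/negP; rewrite -ltnNge.
  by apply: leq_trans lt _; rewrite addnA leq_addl.
apply: shA bt _ bS _; last by rewrite last_cat /= lq'.
by move=> z; rewrite -cat_cons mem_cat => /orP[/sbt|/sarA].
Qed.

(** * Base cases, the bound, and the double induction *)

Lemma conn1 x : conn [set x].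
Proof. by apply: (@conn_base _ x) => [|y]; rewrite !inE // => /eqP ->. Qed.

Lemma edge_biconn x y : x != y -> e x y -> biconn [set x; y].
Proof.
move=> xy exy; have yx : y != x by rewrite eq_sym.
apply/andP; split.
  apply: (@conn_base _ x) => [|z]; rewrite !inE ?eqxx // => /orP[]/eqP-> //.
  by apply: connect1; rewrite /within /= !inE !eqxx orbT.
apply/forall_inP => v; rewrite !inE => /orP[]/eqP->; apply/orP; right.
  by rewrite setU1K ?inE // conn1.
by rewrite setUC setU1K ?inE // conn1.
Qed.

(** A connected set with two vertices contains an edge, which is biconnected and is not emptied by
    one deletion. *)
Lemma elim2_1_conn A : irreflexive e -> elim2 1 A -> conn A -> #|A| <= 1.
Proof.
move=> e_irr el /connP[_ cA]; rewrite leqNgt; apply/negP => /card_gt1P[a [b [aA bA ab]]].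
have /connectP[[|c p]] := cA a b aA bA; first by move=> _ ba; rewrite ba eqxx in ab.
case/andP=> /and3P[_ cA' eac] _ _.
have ac : a != c by apply: contraTneq eac => ->; rewrite e_irr.
have [|v v0] := el _ _ (edge_biconn ac eac); first by rewrite subUset !sub1set aA.
have := cards2 a c; rewrite ac (cardsD1 v) [_ :\ v]v0 cards0 addn0.
by case: (v \in _).
Qed.

Lemma elim_card_le1 A S : #|A :&: S| <= 1 -> elim S 1 A.
Proof.
move=> A1 C sCA /connP[/set0Pn[v0 v0C] _].
have [CS0|/set0Pn[v vCS]] := eqVneq (C :&: S) set0.
  by exists v0; apply: disjointWl (subsetDl _ _) _; rewrite -setI_eq0 CS0.
exists v; rewrite /= -setI_eq0 setIDAC -cards_eq0.
have := leq_trans (subset_leq_card (setSI S sCA)) A1.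
by rewrite (cardsD1 v) vCS add1n ltnS leqn0.
Qed.

(* Here [k.+1] bounds the 2-treedepth. *)
Definition elim_bound s k := (2 * 'C(s + k, s)).-1.

Lemma elim_boundS s k :
  elim_bound s.+1 k.+1 = elim_bound s k.+1 + (elim_bound s.+1 k).+1.
Proof.
rewrite /elim_bound addSn binS -addSnnS addSn mulnDr [in RHS]addnC addSnnS.
have : 0 < 'C(s + k.+1, s) by rewrite bin_gt0 leq_addr.
have : 0 < 'C((s + k).+1, s.+1) by rewrite bin_gt0 ltnS leq_addr.
rewrite -addnS.
by case: 'C(_, _) => // a _; case: 'C(_, _) => // b _; rewrite !mulnS.
Qed.

(** The set [A] itself is gated and contains [X], so a minimal such set exists inside it. *)
Lemma minimal_gated A X : conn A -> X \subset A ->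
    exists2 M : {set T}, M \subset A & minset (fun M : {set T} => gated A M && (X \subset M)) M.
Proof.
move=> cA sXA; pose P M := gated A M && (X \subset M).
suff /(minset_exists (P := P))[M minM sMA] : P A by exists M.
rewrite /P sXA andbT; apply/gatedP => Y sYA cY; right.
by rewrite (setIidPl sYA).
Qed.

Lemma elim_short_paths s k A S : irreflexive e -> elim2 k.+1 A ->
  short_paths A S s -> elim S (elim_bound s k) A.
Proof.
move=> e_irr; elim: s k A S => [|s IHs] k A S.
  (* For [s = 0] the bound is 1: an induced path joining two distinct vertices of [S] would have an
     edge, so a connected set has at most one vertex of [S]. *)
  move=> _ shA; rewrite /elim_bound bin0 muln1 => C sCA cC; apply: (elim_card_le1 _ (subxx C)) => //.
  have [_ cCP] := connP _ cC.
  rewrite leqNgt; apply/negP => /card_gt1P[a [b [/setIP[aC aS] /setIP[bC bS] ab]]].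
  have [p [ap lp sp]] := connect_ipath aC (cCP a b aC bC).
  have : size p <= 0.*2.
    by apply: shA ap _ aS _; rewrite ?lp // => z /sp; apply: subsetP.
  by case: p lp {ap sp} => //= ba; rewrite ba eqxx in ab.
elim: k A S => [|k IHk] A S elA shA.
  rewrite /elim_bound addn0 binn muln1 => C sCA cC; apply: (elim_card_le1 _ (subxx C)) => //.
  apply: leq_trans (subset_leq_card (subsetIl _ _)) _.
  exact: elim2_1_conn (elim2_sub sCA elA) cC.
(* The successor is exposed only to pass to a connected [B], as [short_paths_separators]
   requires. *)
rewrite elim_boundS addnS; apply: elim_conn => B sBA cB; rewrite -addnS.
have elB := elim2_sub sBA elA; have shB := short_paths_sub sBA shA.
have elS := IHs _ _ _ elB (short_paths_separators cB shB).
apply: elim_add elS _ => D sDB dD.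
move=> C sCD cC; have sCB := subset_trans sCD sDB.
have [CS0|/set0Pn[a /setIP[aC aS]]] := eqVneq (C :&: S) set0.
  have [/set0Pn[v _] _] := connP _ cC; exists v; apply: elim_disjoint.
  by apply: disjointWl (subsetDl _ _) _; rewrite -setI_eq0 CS0.
have sCSB : C :&: S \subset B by apply: subset_trans sCB; apply: subsetIl.
have [M sMB minM] := minimal_gated cB sCSB.
have bM : biconn M.
  apply: minimal_gated_biconn minM => //; first by exists a; rewrite inE aC.
  move=> v b c /setIP[bC bS] /setIP[cC' cS] bv cv.
  have [_ cCP] := connP _ cC.
  (* A vertex outside [C] cannot separate because [C] is connected; one inside [C] is no separator,
     since those are already eliminated. *)
  have [vC|vC] := boolP (v \in C); last first.
    apply: connect_within_mono (cCP b c bC cC').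
    by apply/subsetP => z zC; rewrite !inE (subsetP sCB) // andbT; apply: contraNneq vC => <-.
  have : v \notin separators B S.
    by apply: contraL (subsetP sCD _ vC) => vS; rewrite (disjointFl dD).
  rewrite inE (subsetP sCB) //= => /exists_inPn/(_ b).
  rewrite !inE bS bv (subsetP sCB) // => /(_ isT)/exists_inPn/(_ c).
  by rewrite !inE cS cv (subsetP sCB) // negbK; apply.
(* Deleting [x] is the extra round in [elim_boundS]; [elim_gated] then reduces [C :\ x] to a subset
   of [M :\ x]. *)
have [x elx] := elB M sMB bM; exists x.
have /andP[gM sCSM] := minsetp minM.
apply: (@elim_gated B M) => //.
- exact: subset_trans (subsetDl _ _) sCB.
- by apply: subset_trans sCSM; rewrite setSI // subsetDl.
apply: (@elim_sub _ _ _ (M :\ x)).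
  by rewrite setIDAC setSD // subsetIr.
apply: IHk elx (short_paths_sub _ shB).
exact: subset_trans (subsetDl _ _) sMB.
Qed.
End Elimination.

(** * Dependence of elimination on the relation *)

Section ChangeRelation.

Variables (T : finType) (e e' : rel T).
Implicit Types (A C S : {set T}).

Lemma conn_mono A : {in A &, subrel e e'} -> conn e A -> conn e' A.
Proof.
move=> see' /connP[A0 cA]; apply/connP; split=> // x y xA yA.
apply: connect_sub (cA x y xA yA) => {}x {}y /and3P[{}xA {}yA exy].
by apply: connect1; rewrite /within /= xA yA see'.
Qed.

Lemma elim_mono S n A : {in A &, subrel e e'} -> elim e' S n A -> elim e S n A.
Proof.
elim: n A => //= n IH A see' H C sCA cC; have inA := subsetP sCA.
have see'C : {in C &, subrel e e'} by move=> x y /inA xA /inA; apply: see'.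
have [v Hv] := H C sCA (conn_mono see'C cC); exists v; apply: IH Hv => x y.
by move=> /setD1P[_ xC] /setD1P[_]; apply: see'C.
Qed.

End ChangeRelation.

Lemma biconn_eq (T : finType) (e e' : rel T) (A : {set T}) :
  {in A &, e =2 e'} -> biconn e A -> biconn e' A.
Proof.
move=> ee' /andP[cA bA]; apply/andP; split.
  by apply: conn_mono cA => x y xA yA; rewrite ee'.
apply/forall_inP => v vA; have := forall_inP bA v vA => /orP[->//|cAv].
apply/orP; right; apply: conn_mono cAv => x y /setD1P[_ xA] /setD1P[_ yA].
by rewrite ee'.
Qed.

Lemma elim2_eq (T : finType) (e e' : rel T) n (A : {set T}) :
  {in A &, e =2 e'} -> elim2 e n A -> elim2 e' n A.
Proof.
elim: n A => //= n IH A ee' H C sCA bC; have inA := subsetP sCA.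
have ee'C : {in C &, e =2 e'} by move=> x y /inA xA /inA; apply: ee'.
have [|v Hv] := H C sCA; first by apply: biconn_eq bC => x y xC yC; rewrite ee'C.
exists v; apply: IH Hv => x y /setD1P[_ xC] /setD1P[_]; exact: ee'C.
Qed.

(** * Passage between graphs and elimination *)

Section Transfer.

Variable T : finType.
Implicit Types (G H K : graph T) (A C : {set T}).

Lemma adj_sym G : symmetric (adj G).
Proof. by move=> x y; rewrite /adj /= setUC. Qed.

Lemma adj_edge G x y : adj G x y -> [/\ x \in vset G, y \in vset G & x != y].
Proof.
move=> xy; have /andP[/subsetP sV /eqP c2] := forall_inP (graph_valP G) _ xy.
by split; [apply: sV; rewrite !inE eqxx | apply: sV; rewrite !inE eqxx orbT |
  move: c2; rewrite cards2; case: eqP].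
Qed.

Lemma adj_irr G : irreflexive (adj G).
Proof. by move=> x; apply/negP => /adj_edge[_ _]; rewrite eqxx. Qed.

Lemma adj_induced G A x y :
  adj (induced G A) x y = [&& adj G x y, x \in A & y \in A].
Proof. by rewrite /adj /eset /= inE subUset !sub1set. Qed.

Lemma adj_subgraph H G : subgraph H G -> subrel (adj H) (adj G).
Proof. by move=> /andP[_ /subsetP sE] x y; apply: sE. Qed.

Lemma connected_conn G : connected G = conn (adj G) (vset G).
Proof.
rewrite /connected /conn; congr (_ && _); apply: eq_forallb_in => x xG.
apply: eq_forallb_in => y yG; apply: eq_connect => u v /=; rewrite /within /=.
by case: (boolP (adj G u v)) => [/adj_edge[-> ->]|]; rewrite ?andbF.
Qed.

Lemma elim_td n G : elim (adj G) setT n (vset G) -> td G <= n.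
Proof.
elim: n G => [|n IH] G /=.
  by rewrite -setI_eq0 setIT => /eqP/td_null ->.
have conn_td H : elim (adj H) setT n.+1 (vset H) -> connected H -> td H <= n.+1.
  move=> /= elH cH; have := cH; rewrite connected_conn => cH'.
  have [v Hv] := elH _ (subxx _) cH'.
  (* A round of [elim] may name a vertex outside [H]; then [n] rounds already suffice. *)
  have [vH|vH] := boolP (v \in vset H); last first.
    apply: leqW; apply: IH; congr (elim _ _ _ _): Hv; apply/setDidPl.
    by rewrite disjoint_sym disjoints1.
  rewrite td_connected // addn1 ltnS.
  have [min_le _] := min_overP (fun u => td (del H u)) vH.
  apply: leq_trans (min_le v vH) _; apply: IH; rewrite /del /vset /= -setDE.
  by apply: elim_mono Hv => x y _ _; rewrite adj_induced => /andP[].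
move=> elG; rewrite /td depthE; case: eqP => // _; case: ifPn => [cG|ncG].
  by have := conn_td G elG cG; rewrite /td depthE cG ifN //; case/andP: cG.
apply/bigmax_leqP => H; rewrite inE => /and3P[sHG cH _]; apply: conn_td => //.
have /andP[sV _] := sHG; apply: elim_sub sV _.
by apply: (@elim_mono _ _ (adj G)) => // x y _ _; apply: adj_subgraph.
Qed.

Lemma biconn_is_block G : biconn (adj G) (vset G) -> is_block G.
Proof.
move=> /andP[cG bG]; rewrite /is_block connected_conn cG; apply/forallP => v.
rewrite /cut_vertex negb_and -implybE; apply/implyP => vG; rewrite -leqNgt.
have -> : components G = [set G] by apply: maximal_subgraphs_self; rewrite connected_conn.
rewrite cards1; have := forall_inP bG v vG.
have -> : vset G :\ v = vset (del G v) by rewrite /del /vset /= -setDE.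
case/orP=> [/eqP V0|cGv].
  rewrite leq_eqVlt ltnS leqn0 cards_eq0; apply/orP; right; apply/set0Pn => -[H].
  by rewrite inE => /and3P[/andP[sV _] /andP[/negP[]]]; rewrite -subset0 -V0.
rewrite /components maximal_subgraphs_self ?cards1 // connected_conn.
apply: conn_mono cGv => x y; rewrite !inE => /andP[_ xv] /andP[_ yv].
by rewrite adj_induced !inE xv yv !andbT.
Qed.

Lemma subgraph_refl G : subgraph G G.
Proof. by rewrite /subgraph !subxx. Qed.

Lemma subgraph_trans H G K : subgraph G H -> subgraph H K -> subgraph G K.
Proof.
move=> /andP[sV sE] /andP[sV' sE'].
by rewrite /subgraph (subset_trans sV) ?(subset_trans sE).
Qed.

Lemma sub_maximal_subgraph (P : pred (graph T)) G H : subgraph H G -> P H ->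
  exists2 K, K \in maximal_subgraphs P G & subgraph H K.
Proof.
move=> sHG PH; pose Q K := [&& subgraph H K, subgraph K G & P K].
have QH : Q H by rewrite /Q subgraph_refl sHG.
case: (@arg_maxnP _ H Q (@gsize T) QH) => K /and3P[sHK sKG PK] maxK.
exists K => //; rewrite inE sKG PK; apply/forallP => L; apply/implyP.
case/and3P=> sKL sLG PL; apply/eqP/esym/eqP; apply: contraT => nKL.
have := gsize_sub sKL nKL; rewrite ltnNge => /negP[]; apply: maxK.
by rewrite /Q sLG PL (subgraph_trans sHK sKL).
Qed.

Lemma induced_subgraph G A : subgraph (induced G A) G.
Proof.
rewrite /subgraph subsetIl; apply/subsetP => f.
by rewrite /eset /= inE => /andP[].
Qed.

(** In a graph that is not a block, a biconnected set induces a block and so lies in a maximal one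
    [H], which is smaller than [G] and has the same adjacency on that set. *)
Lemma td2_elim2 k G : td2 G <= k -> elim2 (adj G) k (vset G).
Proof.
have [n] := ubnP (gsize G); elim: n G k => // n IH G k; rewrite ltnS => ltG.
rewrite /td2 depthE; have [G0 _|G0] := eqVneq (vset G) set0.
  case: k => [|k]; rewrite /= G0 // => C; rewrite subset0 => /eqP ->.
  by rewrite /biconn /conn eqxx.
have /set0Pn[v0 v0G] := G0.
case: ifPn => [bG|nbG].
  have [_ [x xG ->]] := min_overP (fun v => depth (@is_block T) (del G v)) v0G.
  case: k => // k; rewrite ltnS => /(IH _ _ (leq_trans (gsize_del xG) ltG)).
  have -> : vset (del G x) = vset G :\ x by rewrite /del /vset /= -setDE.
  move=> elx C sCG /andP[/connP[/set0Pn[v vC] _] _].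
  have {}elx : elim2 (adj G) k (vset G :\ x).
    apply: elim2_eq elx => y z; rewrite !inE => /andP[yx _] /andP[zx _].
    by rewrite adj_induced !inE yx zx !andbT.
  have [xC|xC] := boolP (x \in C).
    by exists x; apply: elim2_sub elx; apply: setSD.
  exists v; apply: elim2_sub elx; apply: subset_trans (subsetDl _ _) _.
  by rewrite subsetD1 sCG.
move/bigmax_leqP => le_k; have block_elim C : C \subset vset G -> biconn (adj G) C ->
    exists2 H, elim2 (adj H) k (vset H) & C \subset vset H /\ {in C &, adj H =2 adj G}.
  move=> sCG bC; have vC : vset (induced G C) = C by rewrite /vset /= (setIidPr sCG).
  have biC : is_block (induced G C).
    apply: biconn_is_block; rewrite vC; apply: biconn_eq bC => x y xC yC.
    by rewrite adj_induced xC yC !andbT.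
  have [H HG sCH] := sub_maximal_subgraph (induced_subgraph G C) biC.
  exists H; first by apply: IH (le_k H HG); apply: leq_trans (gsize_part nbG HG) ltG.
  split; first by have /andP[] := sCH; rewrite vC.
  move=> x y xC yC; apply/idP/idP => [|xy].
    by apply: adj_subgraph; move: HG; rewrite inE => /and3P[].
  by apply: (adj_subgraph sCH); rewrite adj_induced xy xC.
(* The case [k = 0] is impossible: a vertex [v0] lies in some block, which would have to be
   empty. *)
case: k {IH ltG le_k} block_elim => [|k] block_elim.
  have [||H /= H0 [sH _]] := block_elim [set v0]; first by rewrite sub1set.
    rewrite /biconn conn1 /=; last exact: adj_sym.
    by apply/forall_inP => v /set1P->; rewrite setDv eqxx.
  by move: sH; rewrite H0 sub1set inE.
move=> C sCG bC; have [H elH [sCH eqC]] := block_elim C sCG bC.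
have [|v Hv] := elH C sCH; first by apply: biconn_eq bC => x y xC yC; rewrite eqC.
exists v; apply: elim2_eq Hv => x y /setD1P[_ xC] /setD1P[_ yC]; exact: eqC.
Qed.

End Transfer.

(** * Induced paths as copies of [path_graph], and the final bound *)

Lemma ipath_adj (T : finType) (e : rel T) x0 s i j : symmetric e -> irreflexive e ->
  ipath e s -> i < size s -> j < size s ->
  e (nth x0 s i) (nth x0 s j) = (j == i.+1) || (i == j.+1).
Proof.
move=> e_sym e_irr; wlog ij : i j / i <= j.
  move=> H ip si sj; case: (leqP i j) => [|/ltnW] le; first exact: H.
  by rewrite e_sym orbC; apply: H.
elim: s i j ij => // x p IH [|i] [|j] //= ij /and4P[xp exp nexp ip]; rewrite ?ltnS.
- move=> _ jp; case: p j xp exp nexp jp {IH ip ij} => // y p [|j] /= _ exy.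
    by rewrite exy.
  move=> nex; rewrite ltnS => jp; apply/negbTE; apply: (hasPn nex); exact: mem_nth.
- by move=> si sj; rewrite IH.
Qed.

Lemma adj_path_graph t (i j : 'I_t) :
  adj (path_graph t) i j = (j == i.+1 :> nat) || (i == j.+1 :> nat).
Proof.
have nS (u v : 'I_t) : v = u.+1 :> nat -> u != v.
  by move=> vu; rewrite -val_eqE /= vu ltn_eqF.
rewrite /adj /eset /= inE; apply/existsP/orP => [[u /existsP[v /andP[/eqP vu /eqP uv]]]|].
  have ij : i != j.
    by have := cards2 u v; rewrite -uv cards2 (nS _ _ vu); case: (i != j).
  have : (i \in [set u; v]) && (j \in [set u; v]) by rewrite -uv !inE !eqxx orbT.
  move: ij; rewrite !inE => /[swap] /andP[/orP[]/eqP-> /orP[]/eqP->];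
    by rewrite ?vu !eqxx; auto.
case=> ij; [exists i; apply/existsP; exists j | exists j; apply/existsP; exists i].
  by rewrite ij eqxx.
by rewrite ij setUC eqxx.
Qed.

Lemma ipath_not_free (T : finType) (G : graph T) s :
  0 < size s -> ipath (adj G) s -> {subset s <= vset G} -> ~ free (path_graph (size s)) G.
Proof.
move=> s0 ip sG; apply; pose A := [set z in s]; have sA : A \subset vset G.
  by apply/subsetP => z; rewrite inE => /sG.
exists A => //; case: s => [//|x0 s] in s0 ip sG A sA *.
have memA (i : 'I_(size (x0 :: s))) : nth x0 (x0 :: s) i \in vset (induced G A).
  by rewrite /vset /= (setIidPr sA) inE mem_nth.
pose f (i : {i | i \in vset (path_graph (size (x0 :: s)))}) :
  {y | y \in vset (induced G A)} := exist _ (nth x0 (x0 :: s) (val i)) (memA (val i)).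
have us := ipath_uniq ip.
have fA i : val (f i) \in A by rewrite inE mem_nth.
exists f; split=> [|i j]; last first.
  rewrite adj_induced !fA !andbT adj_path_graph.
  by apply: ipath_adj; [exact: adj_sym|exact: adj_irr| | |].
apply: inj_card_bij => [i j /(congr1 val)/eqP|].
  by rewrite /= nth_uniq // => /eqP/val_inj/val_inj.
rewrite !card_sig (eq_card (B := A)) => [|z]; last first.
  by rewrite -[in RHS](setIidPr sA).
rewrite cardsE (card_uniqP us) (eq_card (B := predT)) ?card_ord // => z.
by rewrite unfold_in /= in_setT.
Qed.

Theorem theorem1 (t : nat) (ht : 2 <= t) (k : nat) (hk : 1 <= k)
    (T : finType) (G : graph T) (hfree : free (path_graph t) G)
    (htd2 : td2 G <= k) :
  td G < 2 * 'C((t - 1) %/ 2 + k - 1, (t - 1) %/ 2).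
Proof.
case: k hk htd2 => // k _ /td2_elim2 elG; rewrite addnS subn1 /=.
set s := _ %/ 2.
suff /elim_td : elim (adj G) setT (elim_bound s k) (vset G).
  (* The binomial coefficient is positive, so the predecessor in [elim_bound] makes the inequality
     strict. *)
  move=> le_td; apply: leq_ltn_trans le_td _; rewrite /elim_bound ltn_predL.
  by rewrite muln_gt0 bin_gt0 leq_addr.
apply: elim_short_paths elG _; [exact: adj_sym|exact: adj_irr|].
move=> x p xp sG _ _; rewrite leqNgt; apply/negP => lt.
(* Division by 2 gives [t - 1 <= 2s + 1], and a path violating the bound has at least [2s + 2]
   vertices; its last [t] vertices induce the forbidden path. *)
have le_t : t <= size (x :: p).
  have : (t - 1) %% 2 <= 1 by rewrite -ltnS ltn_mod.
  rewrite -(leq_add2l (s * 2)) -divn_eq muln2 leq_subLR add1n addn1 => le.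
  exact: leq_trans le _.
have := @ipath_not_free _ G (drop (size (x :: p) - t) (x :: p)).
rewrite size_drop subKn //; apply=> //; first exact: ltnW.
  by apply: (@ipath_catr _ _ (take (size (x :: p) - t) (x :: p))); rewrite cat_take_drop.
by move=> z /mem_drop/sG.
Qed.
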